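(* Let $F$ be a field of characteristic $p\neq 0$, let $n\ge 1$, and let $A_1$ and $A_n$ be the Weyl algebras over $F$. Then every $F$-algebra homomorphism $\varphi: A_1\to A_n$ is injective.
   Context: For $n\ge 1$ the Weyl algebra $A_n$ over $F$ is the associative unital $F$-algebra generated by $2n$ elements $x_1,\ldots,x_n,y_1,\ldots,y_n$ subject to the relations $[x_i,y_j]=\delta_{ij}$, $[x_i,x_j]=0$, $[y_i,y_j]=0$ for $1\le i,j\le n$, where $[a,b]=ab-ba$ and $\delta_{ij}$ is the Kronecker symbol. Homomorphisms are unital and $F$-linear. *)

(* Defs.v *)
From HB Require Import structures.
From mathcomp Require Import all_boot all_order all_algebra.
From mathcomp Require Import finmap boolp.
From mathcomp.multinomials Require Import mpoly.
From mathcomp.multinomials Require Import monalg.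

Set Implicit Arguments.
Unset Strict Implicit.
Unset Printing Implicit Defensive.

Import GRing.Theory.
Local Open Scope ring_scope.
Local Open Scope quotient_scope.

(* mpoly shadows this notation of monalg. *)
Local Notation "g @_ k" := (monalg.mcoeff k g) : ring_scope.

(* The two-sided ideal generated by S; closure under opposites follows from
   closure under multiplication by -1. *)
Inductive ideal_gen (R : nzRingType) (S : R -> Prop) : R -> Prop :=
| ideal_gen_in r : S r -> ideal_gen S r
| ideal_gen0 : ideal_gen S 0
| ideal_genD r s : ideal_gen S r -> ideal_gen S s -> ideal_gen S (r + s)
| ideal_genMl a r : ideal_gen S r -> ideal_gen S (a * r)
| ideal_genMr r a : ideal_gen S r -> ideal_gen S (r * a).

(* A monoid algebra of a free monoid, i.e. the free unital associative
   F-algebra; inl i and inr i name the generators x_i and y_i. *)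
Definition free_alg (F : fieldType) (n : nat) :=
  {malg F[{fmonom ('I_n + 'I_n)%type}]}.
HB.instance Definition _ F n := GRing.Lalgebra.on (free_alg F n).

Section Presentation.
Variables (F : fieldType) (n : nat).

Definition free_x (i : 'I_n) : free_alg F n := << fmu (inl i) >>.
Definition free_y (i : 'I_n) : free_alg F n := << fmu (inr i) >>.

Definition commutator (R : nzRingType) (a b : R) : R := a * b - b * a.

Inductive weyl_rel : free_alg F n -> Prop :=
| weyl_rel_xy i j : weyl_rel (commutator (free_x i) (free_y j) - (i == j)%:R)
| weyl_rel_xx i j : weyl_rel (commutator (free_x i) (free_x j))
| weyl_rel_yy i j : weyl_rel (commutator (free_y i) (free_y j)).

Definition weyl_ideal : {pred free_alg F n} :=
  fun g => `[< ideal_gen weyl_rel g >].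

Lemma weyl_idealP g : reflect (ideal_gen weyl_rel g) (g \in weyl_ideal).
Proof. exact: asboolP. Qed.

Lemma weyl_ideal_zmod : zmod_closed weyl_ideal.
Proof.
split; first by apply/weyl_idealP/ideal_gen0.
move=> g h /weyl_idealP Ig /weyl_idealP Ih; apply/weyl_idealP.
by apply: ideal_genD => //; rewrite -mulN1r; apply: ideal_genMl.
Qed.

HB.instance Definition _ :=
  GRing.isZmodClosed.Build (free_alg F n) weyl_ideal weyl_ideal_zmod.

Lemma weyl_idealMl a g : g \in weyl_ideal -> a * g \in weyl_ideal.
Proof. by move=> /weyl_idealP Ig; apply/weyl_idealP/ideal_genMl. Qed.

Lemma weyl_idealMr g a : g \in weyl_ideal -> g * a \in weyl_ideal.
Proof. by move=> /weyl_idealP Ig; apply/weyl_idealP/ideal_genMr. Qed.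

Lemma weyl_idealZ c g : g \in weyl_ideal -> c *: g \in weyl_ideal.
Proof. by move=> Ig; rewrite -[g]mul1r scalerAl weyl_idealMl. Qed.

(* The ideal is proper: the quotient acts on F[X_1, ..., X_n], x_i as the i-th
   partial derivative and y_i as the multiplication by X_i. *)
Local Notation poly := (mpoly.mpoly n F).

Definition free_gen_act (k : 'I_n + 'I_n) : poly -> poly :=
  match k with
  | inl i => mpoly.mderiv i
  | inr i => fun p => mpoly.mpolyX F (mpoly.mnm1 i) * p
  end.

Lemma free_gen_actP k : linear (free_gen_act k).
Proof.
case: k => i c p q /=; first by rewrite linearP.
by rewrite mulrDr scalerAr.
Qed.

Definition word_act (w : {fmonom ('I_n + 'I_n)%type}) (p : poly) : poly :=
  foldr free_gen_act p (fmonom_val w).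

Lemma word_actP w : linear (word_act w).
Proof.
case: w => w c p q; rewrite /word_act /=.
by elim: w => //= k w ->; rewrite free_gen_actP.
Qed.
HB.instance Definition _ w :=
  GRing.isLinear.Build F poly poly *:%R (word_act w) (word_actP w).

Definition free_act (g : free_alg F n) (p : poly) : poly :=
  \sum_(w <- msupp g) g@_w *: word_act w p.

Lemma free_actEw (d : {fset {fmonom ('I_n + 'I_n)%type}}) g p :
  (msupp g `<=` d)%fset -> free_act g p = \sum_(w <- d) g@_w *: word_act w p.
Proof.
move=> le; rewrite [LHS](big_fset_incl _ le) => //= w wd /mcoeff_outdom ->.
by rewrite scale0r.
Qed.

Lemma free_actU c w p : free_act << c *g w >> p = c *: word_act w p.
Proof. by rewrite (free_actEw _ msuppU_le) big_seq_fset1 mcoeffUU. Qed.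

Lemma free_actB g h p : free_act (g - h) p = free_act g p - free_act h p.
Proof.
pose d := (msupp g `|` msupp h)%fset.
rewrite !(@free_actEw d) ?fsubsetUl ?fsubsetUr ?msuppB_le //.
by rewrite -sumrB; apply: eq_bigr => w _; rewrite mcoeffB scalerBl.
Qed.

Definition free_act_at (p : poly) (g : free_alg F n) : poly := free_act g p.
HB.instance Definition _ p := GRing.isZmodMorphism.Build (free_alg F n) poly
  (free_act_at p) (fun g h => free_actB g h p).

Lemma free_act0 p : free_act 0 p = 0.
Proof. exact: (raddf0 (free_act_at p)). Qed.

Lemma free_actD g h p : free_act (g + h) p = free_act g p + free_act h p.
Proof. exact: (raddfD (free_act_at p)). Qed.

Lemma free_actMn g k p : free_act (g *+ k) p = free_act g p *+ k.
Proof. exact: (raddfMn (free_act_at p)). Qed.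

Lemma free_act_sum (J : Type) (r : seq J) (G : J -> free_alg F n) p :
  free_act (\sum_(j <- r) G j) p = \sum_(j <- r) free_act (G j) p.
Proof. exact: (raddf_sum (free_act_at p)). Qed.

Lemma free_act_is_linear g : linear (free_act g).
Proof.
move=> c p q; rewrite /free_act scaler_sumr -big_split /=.
by apply: eq_bigr => w _; rewrite linearP scalerDr !scalerA mulrC.
Qed.
HB.instance Definition _ g :=
  GRing.isLinear.Build F poly poly *:%R (free_act g) (free_act_is_linear g).

Lemma free_actM g h p : free_act (g * h) p = free_act g (free_act h p).
Proof.
rewrite malgME free_act_sum [RHS]/free_act; apply: eq_bigr => w _.
rewrite free_act_sum {2}/free_act linear_sum scaler_sumr.
apply: eq_bigr => v _; rewrite /= free_actU linearZ scalerA.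
by rewrite /word_act fmM foldr_cat.
Qed.

Lemma free_act_x i p : free_act (free_x i) p = mpoly.mderiv i p.
Proof. by rewrite free_actU scale1r /word_act fmU. Qed.

Lemma free_act_y i p :
  free_act (free_y i) p = mpoly.mpolyX F (mpoly.mnm1 i) * p.
Proof. by rewrite free_actU scale1r /word_act fmU. Qed.

Lemma free_act1 p : free_act 1 p = p.
Proof. by rewrite free_actU scale1r /word_act fm1. Qed.

Lemma free_act_comm g h p : free_act (commutator g h) p =
  free_act g (free_act h p) - free_act h (free_act g p).
Proof. by rewrite free_actB; congr (_ - _); apply: free_actM. Qed.

Lemma mderiv_mulX i j (p : poly) :
  mpoly.mderiv i (mpoly.mpolyX F (mpoly.mnm1 j) * p) =
  p *+ (i == j) + mpoly.mpolyX F (mpoly.mnm1 j) * mpoly.mderiv i p.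
Proof.
rewrite mpoly.mderivM mpoly.mderivX mpoly.mnm1E [j == i]eq_sym.
have [->|_] := eqVneq i j; last by rewrite scale0r mul0r.
rewrite scale1r -{1}[mpoly.mnm1 j]mpoly.add0m mpoly.addmK.
by rewrite mpoly.mpolyX0 mul1r.
Qed.

Lemma weyl_rel_act g p : weyl_rel g -> free_act g p = 0.
Proof.
case=> i j.
- rewrite free_actB free_actMn free_act1 free_act_comm.
  rewrite !free_act_x !free_act_y mderiv_mulX.
  by rewrite addrK subrr.
- by rewrite free_act_comm !free_act_x mpoly.mderiv_comm subrr.
- by rewrite free_act_comm !free_act_y mulrCA subrr.
Qed.

Lemma weyl_ideal_act g p : g \in weyl_ideal -> free_act g p = 0.
Proof.
move/weyl_idealP=> Ig; elim: Ig p => {g}.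
- by move=> g /weyl_rel_act.
- by move=> p; rewrite free_act0.
- by move=> g h _ IHg _ IHh p; rewrite free_actD IHg IHh addr0.
- by move=> a g _ IHg p; rewrite free_actM IHg linear0.
- by move=> g a _ IHg p; rewrite free_actM IHg.
Qed.

Lemma weyl_ideal1 : 1 \notin weyl_ideal.
Proof.
apply/negP => /(weyl_ideal_act 1)/eqP; rewrite free_act1.
by rewrite (negPf (oner_neq0 _)).
Qed.

Definition weyl := Quotient.quot weyl_ideal.

HB.instance Definition _ := GRing.Zmodule.on weyl.

Definition weyl_pi (g : free_alg F n) : weyl :=
  \pi_(Quotient.quot weyl_ideal) g.

Lemma weyl_piE g h : weyl_pi g = weyl_pi h <-> g - h \in weyl_ideal.
Proof. by rewrite Quotient.idealrBE; split=> [/eqP|/eqP]. Qed.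

Lemma weyl_piB : zmod_morphism weyl_pi.
Proof. by move=> g h; rewrite /weyl_pi raddfB. Qed.
HB.instance Definition _ :=
  GRing.isZmodMorphism.Build (free_alg F n) weyl weyl_pi weyl_piB.

Definition weyl_repr (a : weyl) : free_alg F n :=
  repr (a : Quotient.quot weyl_ideal).

Lemma weyl_reprK : cancel weyl_repr weyl_pi.
Proof. by move=> a; rewrite /weyl_pi /weyl_repr reprK. Qed.

Lemma weyl_repr_ideal g : weyl_repr (weyl_pi g) - g \in weyl_ideal.
Proof. by apply/weyl_piE; rewrite weyl_reprK. Qed.

Definition weyl_mul : weyl -> weyl -> weyl :=
  lift_op2 (Quotient.quot weyl_ideal) *%R.

Lemma weyl_piM g h : weyl_pi (g * h) = weyl_mul (weyl_pi g) (weyl_pi h).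
Proof.
unlock weyl_mul; apply: esym; apply/weyl_piE.
set g' := weyl_repr (weyl_pi g); set h' := weyl_repr (weyl_pi h).
have -> : g' * h' - g * h = g' * (h' - h) + (g' - g) * h.
  by rewrite mulrBr mulrBl addrA subrK.
apply: rpredD; first exact/weyl_idealMl/weyl_repr_ideal.
exact/weyl_idealMr/weyl_repr_ideal.
Qed.

Lemma weyl_mulA : associative weyl_mul.
Proof.
move=> a b c; rewrite -[a]weyl_reprK -[b]weyl_reprK -[c]weyl_reprK.
by rewrite -!weyl_piM mulrA.
Qed.

Lemma weyl_mul1l : left_id (weyl_pi 1) weyl_mul.
Proof. by move=> a; rewrite -[a]weyl_reprK -weyl_piM mul1r. Qed.

Lemma weyl_mul1r : right_id (weyl_pi 1) weyl_mul.
Proof. by move=> a; rewrite -[a]weyl_reprK -weyl_piM mulr1. Qed.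

Lemma weyl_mulDl : left_distributive weyl_mul +%R.
Proof.
move=> a b c; rewrite -[a]weyl_reprK -[b]weyl_reprK -[c]weyl_reprK.
by rewrite -raddfD -!weyl_piM mulrDl raddfD.
Qed.

Lemma weyl_mulDr : right_distributive weyl_mul +%R.
Proof.
move=> a b c; rewrite -[a]weyl_reprK -[b]weyl_reprK -[c]weyl_reprK.
by rewrite -raddfD -!weyl_piM mulrDr raddfD.
Qed.

Lemma weyl_one_neq0 : weyl_pi 1 != 0.
Proof.
apply: contra weyl_ideal1 => /eqP e.
by rewrite -[1]subr0; apply/weyl_piE; rewrite e raddf0.
Qed.

HB.instance Definition _ := GRing.Zmodule_isNzRing.Build weyl
  weyl_mulA weyl_mul1l weyl_mul1r weyl_mulDl weyl_mulDr weyl_one_neq0.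

Lemma weyl_pi_monoid : monoid_morphism weyl_pi.
Proof. by split=> // g h; rewrite weyl_piM. Qed.
HB.instance Definition _ :=
  GRing.isMonoidMorphism.Build (free_alg F n) weyl weyl_pi weyl_pi_monoid.

Definition weyl_scale (c : F) : weyl -> weyl :=
  lift_op1 (Quotient.quot weyl_ideal) ( *:%R c).

Lemma weyl_piZ c g : weyl_pi (c *: g) = weyl_scale c (weyl_pi g).
Proof.
unlock weyl_scale; apply: esym; apply/weyl_piE; rewrite -scalerBr.
exact/weyl_idealZ/weyl_repr_ideal.
Qed.

Lemma weyl_scaleA c d a : weyl_scale c (weyl_scale d a) = weyl_scale (c * d) a.
Proof. by rewrite -[a]weyl_reprK -!weyl_piZ scalerA. Qed.

Lemma weyl_scale1 : left_id 1 weyl_scale.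
Proof. by move=> a; rewrite -[a]weyl_reprK -weyl_piZ scale1r. Qed.

Lemma weyl_scaleDr : right_distributive weyl_scale +%R.
Proof.
move=> c a b; rewrite -[a]weyl_reprK -[b]weyl_reprK.
by rewrite -raddfD -!weyl_piZ scalerDr raddfD.
Qed.

Lemma weyl_scaleDl a : {morph weyl_scale^~ a : c d / c + d}.
Proof.
by move=> c d; rewrite -[a]weyl_reprK -!weyl_piZ scalerDl raddfD.
Qed.

HB.instance Definition _ := GRing.Zmodule_isLmodule.Build F weyl
  weyl_scaleA weyl_scale1 weyl_scaleDr weyl_scaleDl.

Lemma weyl_scaleAl (c : F) (a b : weyl) : c *: (a * b) = c *: a * b.
Proof.
rewrite -[a]weyl_reprK -[b]weyl_reprK.
move: (weyl_repr a) (weyl_repr b) => g h; rewrite -rmorphM.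
transitivity (weyl_pi (c *: (g * h))); first exact/esym/weyl_piZ.
by rewrite scalerAl rmorphM; congr (_ * _); apply: weyl_piZ.
Qed.
HB.instance Definition _ := GRing.Lmodule_isLalgebra.Build F weyl weyl_scaleAl.

Lemma free_scaleAr (c : F) (g h : free_alg F n) : c *: (g * h) = g * (c *: h).
Proof.
apply/malgP => w; have le := msuppZ_le c h.
apply: etrans (mcoeffZ _ _ _) _.
apply: etrans (congr1 ( *%R c) (mcoeffMl g h w)) _; rewrite mulr_sumr.
apply: esym; apply: etrans (mcoeffMlw w (fsubset_refl (msupp g)) le) _.
apply: eq_bigr => u _; rewrite mulr_sumr; apply: eq_bigr => v _.
by rewrite mcoeffZ mulrnAr mulrCA.
Qed.

Lemma weyl_scaleAr (c : F) (a b : weyl) : c *: (a * b) = a * (c *: b).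
Proof.
rewrite -[a]weyl_reprK -[b]weyl_reprK.
move: (weyl_repr a) (weyl_repr b) => g h; rewrite -rmorphM.
transitivity (weyl_pi (c *: (g * h))); first exact/esym/weyl_piZ.
by rewrite free_scaleAr rmorphM; congr (_ * _); apply: weyl_piZ.
Qed.
HB.instance Definition _ := GRing.Lalgebra_isAlgebra.Build F weyl weyl_scaleAr.

Lemma weyl_pi_scalable : scalable weyl_pi.
Proof. exact: weyl_piZ. Qed.
HB.instance Definition _ := GRing.isScalable.Build F (free_alg F n) weyl *:%R
  weyl_pi weyl_pi_scalable.

Definition weyl_x (i : 'I_n) : weyl := weyl_pi (free_x i).
Definition weyl_y (i : 'I_n) : weyl := weyl_pi (free_y i).

Lemma weyl_pi_rel g : weyl_rel g -> weyl_pi g = 0.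
Proof.
move=> Rg; rewrite -(raddf0 weyl_pi); apply/weyl_piE; rewrite subr0.
exact/weyl_idealP/ideal_gen_in.
Qed.

Lemma weyl_pi_comm g h :
  weyl_pi (commutator g h) = commutator (weyl_pi g) (weyl_pi h).
Proof. by rewrite /commutator rmorphB; congr (_ - _); apply: rmorphM. Qed.

Lemma weyl_comm_xy i j : commutator (weyl_x i) (weyl_y j) = (i == j)%:R.
Proof.
apply/eqP; rewrite -subr_eq0 -weyl_pi_comm -(rmorph_nat weyl_pi).
by rewrite -rmorphB; apply/eqP/weyl_pi_rel; exact: weyl_rel_xy.
Qed.

Lemma weyl_comm_xx i j : commutator (weyl_x i) (weyl_x j) = 0.
Proof. by rewrite -weyl_pi_comm; apply: weyl_pi_rel; exact: weyl_rel_xx. Qed.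

Lemma weyl_comm_yy i j : commutator (weyl_y i) (weyl_y j) = 0.
Proof. by rewrite -weyl_pi_comm; apply: weyl_pi_rel; exact: weyl_rel_yy. Qed.

End Presentation.

(* Main.v *)
Require Import Defs.
From HB Require Import structures.
From mathcomp Require Import all_boot all_order all_algebra.
From mathcomp.multinomials Require Import monalg.
From mathcomp.multinomials Require Import mpoly.
From mathcomp Require Import boolp zify ring.
Set Implicit Arguments.
Unset Strict Implicit.
Unset Printing Implicit Defensive.

(** Let u and v be the images in A_n of the two generators of A_1, so that
    [u, v] = 1.  Since A_1 is spanned by the ordered monomials x^i y^j, it is
    enough to show that the monomials u^i v^j are linearly independent.

    The ambient algebra enters through its symbols.  A_n acts on the polynomials
    in X_1..X_n, Z_1..Z_n, where y_i multiplies by X_i and x_i acts as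
    d/dX_i + Z_i; the symbol of a is a applied to 1.  Writing a in normally
    ordered form shows that a sends g to (symbol of a) * g up to terms of smaller
    total degree (near_star), so leading monomials of symbols, for the graded
    lexicographic order, add up under products.  These properties, recorded in
    symbol_map, are all that is used of A_n.

    Suppose that some nonzero f(u, v) vanishes, where the powers of u are written
    on the left, and let B be the span of the u^i v^j, which is a subalgebra.
    The polynomials whose ordered value vanishes form an ideal of F[X][Y], so the
    part of B of size m in each variable has a dimension that grows linearly
    in m; hence for all a, b in B the products a^i b^j satisfy a linear relation
    (power_relation).  If a and b had distinct leading monomials of the same
    degree, these products would have distinct leading monomials.  Therefore
    elements of B whose symbols have the same degree have proportional leading
    terms, and subtracting a multiple of one from the other lowers the degree
    (lower_span): the graded algebra of B has pieces of dimension at most one.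

    Such a B is commutative up to elements of symbol zero, as a totally ramified
    extension would be.  In characteristic p the element z = u^p is central
    in B, and its degree D is positive.  Pick g in B such that the degree of g
    modulo D generates all degrees modulo D (degree_generator).  Every b in B
    then has, after multiplication by a power of z, the degree of a power of g,
    so b can be replaced by b' = z^K b - c g^e of smaller relative degree.  If t
    commutes with g, then [b', t] = z^K [b, t], so that the degree of b drops
    relative to the degree of its commutator with t; this cannot go on for ever
    (comm_descent).  With t = g the element g commutes with B, hence t can be any
    element of B, and [u, v] = 1 has symbol 0: a contradiction. *)

Import Order.Theory GRing.Theory.
Local Open Scope ring_scope.

(** * Ordered polynomials in two elements with commutator one *)

Section OrderedMonomials.
Variables (F : fieldType) (A : algType F) (u v : A).
Hypothesis uv1 : u * v - v * u = 1.
Local Notation PP := {poly {poly F}}.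

(** The value of a polynomial in X (inner variable) and Y (outer variable) at
    X = u, Y = v, with the powers of u on the left of those of v. *)
Definition ordered_eval (q : PP) : A := (map_poly (horner_alg u) q).[v].
Local Notation ev := ordered_eval.

Lemma ordered_evalB : zmod_morphism ev.
Proof. by move=> q r; rewrite /ev rmorphB hornerD hornerN. Qed.
HB.instance Definition _ := GRing.isZmodMorphism.Build PP A ev ordered_evalB.

Lemma ordered_evalCM c q : ev (c%:P * q) = horner_alg u c * ev q.
Proof. by rewrite /ev rmorphM /= map_polyC hornerCM. Qed.

Lemma ordered_evalMX q : ev (q * 'X) = ev q * v.
Proof. by rewrite /ev rmorphM /= map_polyX hornerMX. Qed.

Lemma ordered_evalMXn q k : ev (q * 'X^k) = ev q * v ^+ k.
Proof.
elim: k => [|k IH]; first by rewrite !expr0 !mulr1.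
by rewrite !exprSr !mulrA ordered_evalMX IH.
Qed.

Lemma ordered_eval1 : ev 1 = 1.
Proof. by rewrite /ev rmorph1 hornerC. Qed.

Lemma ordered_evalXM q : ev ('X%:P * q) = u * ev q.
Proof. by rewrite ordered_evalCM horner_algX. Qed.

Lemma ordered_evalZ c q : ev (c%:P%:P * q) = c *: ev q.
Proof. by rewrite ordered_evalCM horner_algC mulr_algl. Qed.

(** The commutator with v is a derivation that sends u to -1. *)
Lemma mulv_horner_alg c : v * horner_alg u c = horner_alg u c * v - horner_alg u c^`().
Proof.
elim/poly_ind: c => [|c a IH]; first by rewrite deriv0 !rmorph0 mulr0 mul0r subr0.
have gX : horner_alg u (c * 'X) = horner_alg u c * u by rewrite rmorphM /= horner_algX.
have vcu : v * (horner_alg u c * u) =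
    horner_alg u c * u * v - (horner_alg u c + horner_alg u c^`() * u).
  have vu : v * u = u * v - 1 by rewrite -uv1 subKr.
  by rewrite mulrA IH mulrBl -!mulrA vu mulrBr mulr1 opprD addrA.
rewrite derivMXaddC !raddfD /= gX rmorphM /= horner_algX.
rewrite mulrDr vcu mulrDl addrAC -opprD; congr (_ + _ - _).
by rewrite horner_algC mulr_algl mulr_algr.
Qed.

(** Left multiplication by v carried over to polynomials: v passes the powers
    of u at the cost of a derivative in X. *)
Definition lmulv (q : PP) : PP := q * 'X - map_poly (@deriv F) q.

Lemma ordered_eval_lmulv q : ev (lmulv q) = v * ev q.
Proof.
rewrite /lmulv; elim/poly_ind: q => [|q c IH].
  by rewrite mul0r map_poly0 subr0 !raddf0 mulr0.
have -> : map_poly (@deriv F) (q * 'X + c%:P) = map_poly (@deriv F) q * 'X + (c^`())%:P.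
  rewrite raddfD /= map_polyC; congr (_ + _); apply/polyP=> i.
  by rewrite coef_map !coefMX coef_map; case: i => //=; rewrite deriv0.
have -> : (q * 'X + c%:P) * 'X - (map_poly (@deriv F) q * 'X + (c^`())%:P) =
   (q * 'X - map_poly (@deriv F) q) * 'X + (c%:P * 'X - (c^`())%:P) by ring.
rewrite !raddfD !raddfN /= !ordered_evalMX IH mulrDr mulrA; congr (_ + _).
rewrite -[X in X - _]mulr1 -[(c^`())%:P]mulr1 !ordered_evalCM ordered_eval1.
by rewrite -[c%:P]mulr1 !ordered_evalCM ordered_eval1 !mulr1 mulv_horner_alg.
Qed.

(** Sizes in the two variables are bounded separately: lmulv then
    acts on one of them only, and the dimension of a box is a product. *)
Definition in_box s t (q : PP) := (size q <= t)%N /\ forall j, (size (q`_j)%R <= s)%N.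

Lemma in_box_widen s s' t t' q :
  (s <= s')%N -> (t <= t')%N -> in_box s t q -> in_box s' t' q.
Proof.
by move=> ss tt [qt qs]; split=> [|j]; [apply: leq_trans tt | apply: leq_trans ss].
Qed.

Lemma in_box0 s t : in_box s t 0.
Proof. by split=> [|j]; rewrite ?coef0 size_poly0. Qed.

Lemma in_boxD s t q r : in_box s t q -> in_box s t r -> in_box s t (q + r).
Proof.
move=> [qt qs] [rt rs]; split=> [|j]; rewrite ?coefD.
  by apply: leq_trans (size_polyD _ _) _; rewrite geq_max qt.
by apply: leq_trans (size_polyD _ _) _; rewrite geq_max qs rs.
Qed.

Lemma in_box_sum s t I (r : seq I) (Q : pred I) (q : I -> PP) :
  (forall i, Q i -> in_box s t (q i)) -> in_box s t (\sum_(i <- r | Q i) q i).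
Proof. by move=> qb; elim/big_rec: _ => [|i p Qi]; [apply: in_box0 | apply/in_boxD/qb]. Qed.

Lemma in_boxCM s s' t (c : {poly F}) q :
  (size c <= s')%N -> in_box s t q -> in_box (s' + s) t (c%:P * q).
Proof.
move=> cs' [qt qs]; split=> [|j].
  by rewrite mul_polyC; apply: leq_trans (size_scale_leq _ _) _.
rewrite coefCM; apply: leq_trans (size_polyMleq _ _) _.
by apply: leq_trans (leq_pred _) (leq_add cs' (qs j)).
Qed.

Lemma in_box_lmulv s t q : in_box s t q -> in_box s t.+1 (lmulv q).
Proof.
move=> [qt qs]; split=> [|j].
  apply: leq_trans (size_polyD _ _) _; rewrite geq_max size_polyN.
  apply/andP; split.
    by apply: leq_trans (size_polyMleq _ _) _; rewrite size_polyX addn2.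
  by apply: leq_trans (size_poly _ _) (leqW qt).
rewrite coefB coefMX coef_map; apply: leq_trans (size_polyD _ _) _.
rewrite geq_max size_polyN; apply/andP; split.
  by case: eqP => _; rewrite ?size_poly0.
apply: leq_trans (qs j); exact: leq_trans (size_poly _ _) (leq_pred _).
Qed.

Lemma iter_lmulv k s t q : in_box s t q ->
  in_box s (k + t) (iter k lmulv q) /\ ev (iter k lmulv q) = v ^+ k * ev q.
Proof.
move=> qb; elim: k => [|k [IHb IHe]]; first by rewrite expr0 mul1r.
by split; [apply: in_box_lmulv | rewrite iterS ordered_eval_lmulv IHe exprS mulrA].
Qed.

Definition boxed s a := exists2 q, in_box s s q & ev q = a.

Lemma boxed1 : boxed 1 1.
Proof.
exists 1; last exact: ordered_eval1.
by split=> [|j]; rewrite ?size_poly1 // coef1; case: eqP; rewrite ?size_poly1 ?size_poly0.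
Qed.

(** Reordering the product of two ordered polynomials does not raise the size
    in either variable, since moving v across u only produces derivatives. *)
Lemma boxedM s s' a b : boxed s a -> boxed s' b -> boxed (s + s') (a * b).
Proof.
move=> [q1 [qt qs] <-] [q2 qb <-].
exists (\sum_(j < size q1) (q1`_j)%:P * iter j lmulv q2).
  apply: in_box_sum => j _; apply: in_boxCM => //.
  have [jb _] := iter_lmulv j qb; apply: in_box_widen jb => //.
  by rewrite leq_add2r (leq_trans (ltnW (ltn_ord j))).
have -> : ev q1 = \sum_(j < size q1) horner_alg u q1`_j * v ^+ j.
  rewrite -{1}[q1]coefK poly_def raddf_sum; apply: eq_bigr => j _.
  rewrite /= -mul_polyC ordered_evalMXn -[(_)%:P]mulr1.
  by rewrite ordered_evalCM ordered_eval1 mulr1.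
rewrite raddf_sum mulr_suml; apply: eq_bigr => j _.
by rewrite /= ordered_evalCM (iter_lmulv j qb).2 mulrA.
Qed.

Lemma boxedX s a k : boxed s a -> boxed (1 + s * k) (a ^+ k).
Proof.
move=> sa; elim: k => [|k IH]; first by rewrite muln0; apply: boxed1.
by rewrite exprS mulnS addnCA; apply: boxedM.
Qed.

Lemma boxed_widen s s' a : (s <= s')%N -> boxed s a -> boxed s' a.
Proof. by move=> ss [q qb <-]; exists q => //; apply: in_box_widen qb. Qed.

Lemma box_dependent (I : finType) (w : I -> PP) s :
  (forall i, in_box s s (w i)) -> (s * s < #|I|)%N ->
  exists2 la : I -> F, (exists i, la i != 0) & \sum_i (la i)%:P%:P * w i = 0.
Proof.
move=> wb lt.
pose M : 'M[F]_(#|I|, s * s) :=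
  \matrix_(r < #|I|) mxvec (\matrix_(i < s, j < s) (w (enum_val r))`_i`_j).
have ME x (i j : 'I_s) : M (enum_rank x) (mxvec_index i j) = (w x)`_i`_j.
  by rewrite mxE mxvecE mxE enum_rankK.
have nzK : kermx M != 0.
  rewrite kermx_eq0 /row_free; apply: contraTN lt => /eqP <-.
  by rewrite -leqNgt rank_leq_col.
have /matrix0Pn[r [c nz]] := nzK.
pose la i := kermx M r (enum_rank i).
exists la; first by exists (enum_val c); rewrite /la enum_valK.
have sum0 (i j : 'I_s) : \sum_x la x * (w x)`_i`_j = 0.
  have /matrixP/(_ r (mxvec_index i j)) : kermx M *m M = 0 by apply: mulmx_ker.
  rewrite mxE [RHS]mxE => E; rewrite -[RHS]E [RHS](reindex enum_rank) /=; last first.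
    by apply: onW_bij; apply: enum_rank_bij.
  by apply: eq_bigr => x _; rewrite ME.
apply/polyP => i; apply/polyP => j; rewrite !coef0 coef_sum coef_sum.
under eq_bigr => x _ do rewrite !coefCM.
have [si|lti] := leqP s i.
  rewrite big1 // => x _; case: (wb x) => szw _.
  by rewrite [(w x)`_i]nth_default ?coef0 ?mulr0 // (leq_trans szw).
have [sj|ltj] := leqP s j.
  rewrite big1 // => x _; case: (wb x) => _ /(_ i) szw.
  by rewrite [_`_j]nth_default ?mulr0 // (leq_trans szw).
exact: (sum0 (Ordinal lti) (Ordinal ltj)).
Qed.

Lemma in_box_exists q : exists s, in_box s s q.
Proof.
exists (size q + \max_(j < size q) size (q`_j)%R)%N; split=> [|j].
  exact: leq_addr.
have [le|lt] := leqP (size q) j; first by rewrite nth_default // size_poly0.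
apply: leq_trans (leq_addl _ _).
exact: (bigop.bigmax_sup (Ordinal lt)).
Qed.

(** A count of dimensions.  The k^2 lifts of the products a^i b^j and the m^2
    multiples X^i f Y^j lie together in a box of dimension (m + e)^2, where m is
    linear in k; for k large this is smaller than k^2 + m^2.  In the resulting
    relation some lift must occur, because the multiples of f are independent,
    and evaluation kills those multiples: u^i f(u, v) v^j = 0. *)
Lemma power_relation (f : PP) s (a b : A) : f != 0 -> ev f = 0 ->
  boxed s a -> boxed s b ->
  exists k, exists2 la : 'I_k -> 'I_k -> F, (exists i j, la i j != 0) &
    \sum_i \sum_j la i j *: (a ^+ i * b ^+ j) = 0.
Proof.
move=> nzf f0 sa sb.
have [e [fe fs]] := in_box_exists f.
(* m bounds the box of the lifts; k is chosen so that k^2 > 2me + e^2. *)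
pose k := (4 * e + 4 * s * e + e * e).+1; pose m := (2 + 2 * (s * k))%N.
have /fin_all_exists2[lift liftb liftE] :
    forall ij : 'I_k * 'I_k, exists2 q, in_box m m q & ev q = a ^+ ij.1 * b ^+ ij.2.
  move=> [i j] /=.
  have [|q qb qE] := @boxed_widen _ m _ _ (boxedM (boxedX i sa) (boxedX j sb)).
    have : (s * i <= s * k)%N by rewrite leq_mul2l (ltnW (ltn_ord i)) orbT.
    have : (s * j <= s * k)%N by rewrite leq_mul2l (ltnW (ltn_ord j)) orbT.
    rewrite /m; lia.
  by exists q.
pose mult (ij : 'I_m * 'I_m) : PP := ('X^(ij.1))%:P * (f * 'X^(ij.2)).
pose w (x : ('I_k * 'I_k) + ('I_m * 'I_m)) :=
  match x with inl ij => lift ij | inr ij => mult ij end.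
have wb x : in_box (m + e) (m + e) (w x).
  case: x => [ij|[i j]] /=; first by apply: in_box_widen (liftb ij); rewrite leq_addr.
  apply: in_box_widen (in_boxCM (s' := m) (s := e) (t := m + e) _ _) => //.
    by rewrite size_polyXn.
  split=> [|l].
    apply: leq_trans (size_polyMleq _ _) _; rewrite size_polyXn addnS /=.
    by rewrite addnC leq_add // ltnW.
  by rewrite coefMXn; case: ifP; rewrite ?size_poly0.
have lt : ((m + e) * (m + e) < #|{: ('I_k * 'I_k) + ('I_m * 'I_m)}|)%N.
  rewrite card_sum !card_prod !card_ord.
  have -> : ((m + e) * (m + e) = (2 * m * e + e * e) + m * m)%N by nia.
  rewrite ltn_add2r /m.
  have -> : (2 * (2 + 2 * (s * k)) * e + e * e =
      k * (4 * s * e) + (4 * e + e * e))%N by nia.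
  have : (k * k = k * (4 * s * e) + k * (4 * e + e * e) + k)%N by rewrite {2}/k; nia.
  have : (4 * e + e * e <= k * (4 * e + e * e))%N by rewrite leq_pmull.
  by have : (0 < k)%N by []; lia.
have [la [x nzx] sum0] := box_dependent wb lt.
exists k, (fun i j => la (inl (i, j))); last first.
  have := congr1 ev sum0; rewrite raddf0 raddf_sum big_sumType /=.
  rewrite [X in _ + X]big1 ?addr0 => [E|[i j] _]; last first.
    by rewrite ordered_evalZ ordered_evalCM ordered_evalMXn f0 mul0r mulr0 scaler0.
  rewrite -[RHS]E pair_bigA; apply: eq_bigr => -[i j] _ /=.
  by rewrite ordered_evalZ liftE.
have [/existsP[i /existsP[j nz]]|none] := boolP [exists i, exists j, la (inl (i, j)) != 0].
  by exists i, j.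
have la0 ij : la (inl ij) = 0.
  move: none; rewrite negb_exists => /forallP/(_ ij.1).
  by rewrite negb_exists => /forallP/(_ ij.2); rewrite negbK -surjective_pairing => /eqP.
case/negP: nzx; case: x => [ij|ij0]; first by rewrite la0.
pose h := \sum_(ij : 'I_m * 'I_m) (la (inr ij) *: 'X^(ij.1))%:P * 'X^(ij.2).
have h0 : h = 0.
  apply/eqP; rewrite -[_ == 0]orFb -(negPf nzf) -mulf_eq0 -[X in _ == X]sum0.
  rewrite big_sumType /= big1 ?add0r => [|ij _]; last by rewrite la0 mul0r.
  rewrite mulr_sumr; apply/eqP/eq_bigr => ij _.
  by rewrite /mult -mul_polyC polyCM; ring.
have := congr1 (fun q : PP => (q`_ij0.2)`_ij0.1) h0; rewrite !coef0 coef_sum coef_sum.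
rewrite (bigD1 ij0) //= big1 ?addr0 => [|ij ne].
  by rewrite coefCM coefXn eqxx mulr1 coefZ coefXn eqxx mulr1 => ->.
rewrite coefCM coefXn; case: (eqVneq (ij0.2 : nat) ij.2) => [e2|_];
  last by rewrite mulr0 coef0.
rewrite mulr1 coefZ coefXn; case: (eqVneq (ij0.1 : nat) ij.1) => [e1|_];
  last by rewrite mulr0.
case/eqP: ne; case: ij ij0 e1 e2 => [i j] [i0 j0] /= e1 e2.
by congr (_, _); apply/val_inj.
Qed.
End OrderedMonomials.

(** * Independence of the ordered monomials in characteristic p *)

Lemma lincomb_mlead_neq0 (F : fieldType) (k : nat) (I : finType) (la : I -> F)
    (g : I -> mpoly k F) :
  (forall i, g i != 0) -> injective (fun i => mlead (g i)) ->
  (exists i, la i != 0) -> \sum_i la i *: g i != 0.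
Proof.
move=> nzg inj [i0 nz0].
have [i nzi imax] := @arg_maxP _ _ I i0 (fun i => la i != 0)
  (fun i => mlead (g i)) nz0.
apply/eqP => /(congr1 (mcoeff (mlead (g i)))); rewrite mcoeff0 raddf_sum /=.
rewrite (bigD1 i) //= big1 ?addr0 => [|j ne]; rewrite mcoeffZ.
  by apply/eqP; rewrite mulf_neq0 // mleadc_eq0.
have [->|nzj] := eqVneq (la j) 0; first by rewrite mul0r.
rewrite mcoeff_gt_mlead ?mulr0 // lt_neqAle.
apply/andP; split; first by apply: contra ne => /eqP/inj ->.
exact: imax.
Qed.

(** A valuation of A in disguise: its value group is the group of exponents, and
    its residue field is F, since a leading term is determined up to a scalar by
    its monomial.  Elements of symbol zero play the part of zero. *)
Record symbol_map (F : fieldType) (A : algType F) (k : nat) (sym : A -> mpoly k F) : Prop :=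
  SymbolMap {
  symbol_map1 : sym 1 = 1;
  symbol_map_eq0 a b : (sym (a * b) == 0) = (sym a == 0) || (sym b == 0);
  symbol_map_mlead a b : sym a != 0 -> sym b != 0 ->
    mlead (sym (a * b)) = (mlead (sym a) + mlead (sym b))%MM
}.

Section Independence.
Variables (F : fieldType) (p : nat) (A : algType F) (k : nat).
Hypothesis hp : p \in [pchar F].
Variable symbol : {linear A -> mpoly k F}.
Hypothesis symbolP : symbol_map symbol.
Variables u v : A.
Hypothesis uv1 : u * v - v * u = 1.
Local Notation ev := (ordered_eval u v).
Local Notation nz a := (symbol a != 0).

Let symbol1 := symbol_map1 symbolP.
Let mlead_symbolM := symbol_map_mlead symbolP.
Let symbolM_eq0 := symbol_map_eq0 symbolP.

Definition symbol_deg (a : A) := mdeg (mlead (symbol a)).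
Local Notation deg := symbol_deg.

Lemma symbol1_neq0 : nz (1 : A).
Proof. by rewrite symbol1 oner_neq0. Qed.

Lemma symbol_deg1 : deg 1 = 0%N.
Proof. by rewrite /deg symbol1 mlead1 mdeg0. Qed.

Lemma symbolM_neq0 a b : nz a -> nz b -> nz (a * b).
Proof. by rewrite symbolM_eq0 negb_or => -> ->. Qed.

Lemma symbol_degM a b : nz a -> nz b -> deg (a * b) = (deg a + deg b)%N.
Proof. by move=> nza nzb; rewrite /deg (mlead_symbolM nza nzb) mdegD. Qed.

Lemma symbolX_neq0 a i : nz a -> nz (a ^+ i).
Proof.
move=> nza; elim: i => [|i IH]; [exact: symbol1_neq0 | rewrite exprS; exact: symbolM_neq0].
Qed.

Lemma mlead_symbolX a i : nz a -> mlead (symbol (a ^+ i)) = (mlead (symbol a) *+ i)%MM.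
Proof.
move=> nza; elim: i => [|i IH]; first by rewrite mulm0n symbol1 mlead1.
by rewrite exprS (mlead_symbolM nza (symbolX_neq0 i nza)) IH mulmS.
Qed.

Lemma symbol_degX a i : nz a -> deg (a ^+ i) = (deg a * i)%N.
Proof. by move=> nza; rewrite /deg (mlead_symbolX i nza) mdegMn. Qed.

Definition in_span (a : A) := exists q, ev q = a.

Lemma span_ev q : in_span (ev q). Proof. by exists q. Qed.

Lemma spanM a b : in_span a -> in_span b -> in_span (a * b).
Proof.
move=> [q <-] [r <-]; have [s qb] := in_box_exists q; have [t rb] := in_box_exists r.
have [w _ <-] := @boxedM _ _ _ _ uv1 s t (ev q) (ev r)
   (ex_intro2 _ _ q qb erefl) (ex_intro2 _ _ r rb erefl).
exact: span_ev.
Qed.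

Lemma spanB a b : in_span a -> in_span b -> in_span (a - b).
Proof. by move=> [q <-] [r <-]; exists (q - r); exact: ordered_evalB. Qed.

Lemma spanZ c a : in_span a -> in_span (c *: a).
Proof. by move=> [q <-]; exists (c%:P%:P * q); rewrite ordered_evalZ. Qed.

Lemma span1 : in_span 1.
Proof. by exists 1; rewrite ordered_eval1. Qed.

Lemma span_u : in_span u.
Proof. by exists ('X%:P * 1); rewrite ordered_evalXM ordered_eval1 mulr1. Qed.

Lemma span_v : in_span v.
Proof. by exists (1 * 'X); rewrite ordered_evalMX ordered_eval1 mul1r. Qed.

Lemma spanX a i : in_span a -> in_span (a ^+ i).
Proof. by move=> sa; elim: i => [|i IH]; [apply: span1 | rewrite exprS; apply: spanM]. Qed.

Let z := u ^+ p.

(** On powers of u the commutator with v is the derivative, and X^p has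
    derivative zero in characteristic p. *)
Lemma central_span a : in_span a -> z * a = a * z.
Proof.
have zE : z = horner_alg u 'X^p by rewrite rmorphXn /= horner_algX.
have zv : z * v = v * z.
  rewrite zE (mulv_horner_alg uv1) derivXn -mulr_natr.
  have -> : p%:R = 0 :> {poly F} by rewrite -polyC_natr (pcharf0 hp).
  by rewrite mulr0 rmorph0 subr0.
move=> [q <-]; elim/poly_ind: q => [|q c IH].
  by rewrite raddf0 mulr0 mul0r.
rewrite raddfD /= ordered_evalMX -[c%:P]mulr1 ordered_evalCM ordered_eval1 mulr1.
rewrite mulrDr mulrDl; congr (_ + _).
  by rewrite mulrA IH -!mulrA zv.
by rewrite zE -!rmorphM mulrC.
Qed.

Lemma span_z : in_span z. Proof. exact/spanX/span_u. Qed.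

Variable f : {poly {poly F}}.
Hypotheses (nzf : f != 0) (f0 : ev f = 0).

(** With distinct leading monomials of the same positive degree, the products
    a^i b^j would all have different leading monomials: the degree determines
    i + j, and then an exponent where the two differ determines i. *)
Lemma mlead_span a b : in_span a -> in_span b -> nz a -> nz b -> deg a = deg b ->
  mlead (symbol a) = mlead (symbol b).
Proof.
move=> sa sb nza nzb dab; apply/eqP; apply: contraT => ne.
have [s ha] : exists s, boxed u v s a.
  by case: sa => q <-; have [s qb] := in_box_exists q; exists s, q.
have [t hb] : exists s, boxed u v s b.
  by case: sb => q <-; have [t qb] := in_box_exists q; exists t, q.
have := power_relation uv1 nzf f0 (boxed_widen (leq_addr t s) ha)
  (boxed_widen (leq_addl s t) hb).
case=> l [la [i0 [j0 nzla]]] /(congr1 symbol).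
rewrite pair_bigA linear0 linear_sum /= => sum0.
have := @lincomb_mlead_neq0 F k _ (fun ij : 'I_l * 'I_l => la ij.1 ij.2)
  (fun ij => symbol (a ^+ ij.1 * b ^+ ij.2)).
case/(_ _ _ _)/negP.
- by move=> ij; rewrite symbolM_neq0 ?symbolX_neq0.
- have [c nec] : exists c, mlead (symbol a) c != mlead (symbol b) c.
    apply/existsP; apply: contraNT ne; rewrite negb_exists => /forallP e.
    by apply/eqP/mnmP => c; have := e c; rewrite negbK => /eqP.
  have dgt0 : (0 < deg a)%N.
    rewrite lt0n mdeg_eq0; apply: contra ne => /eqP a0.
    by move/eqP: dab; rewrite /deg a0 mdeg0 eq_sym mdeg_eq0 => /eqP ->.
  move=> [i j] [i' j'] /=; rewrite !mlead_symbolM ?symbolX_neq0 // !mlead_symbolX // => e.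
  have ec := congr1 (fun m : 'X_{1..k} => m c) e.
  have ed := congr1 mdeg e; move: ec ed; rewrite !mnmDE !mulmnE !mdegD !mdegMn.
  rewrite -/(deg a) -/(deg b) -dab -!mulnDr => ec /eqP; rewrite eqn_pmul2l // => /eqP ed.
  have ei : i = i' :> nat.
    move: nec ec ed; move: (mlead _ c) (mlead _ c).
    move: (nat_of_ord i) (nat_of_ord i') (nat_of_ord j) (nat_of_ord j').
    move=> i1 i1' j1 j1' x y /eqP; nia.
  by congr (_, _); apply/val_inj => //=; lia.
- by exists (i0, j0).
- by apply/eqP; rewrite -[RHS]sum0; apply: eq_bigr => ij _; rewrite linearZ.
Qed.

(** The case where the difference has symbol zero is left out of the
    conclusion, as its degree has no meaning. *)
Lemma lower_span a b : in_span a -> in_span b -> nz a -> nz b -> deg a = deg b ->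
  exists c, nz (a - c *: b) -> (deg (a - c *: b)%R < deg a)%N.
Proof.
move=> sa sb nza nzb dab; have lab := mlead_span sa sb nza nzb dab.
pose c := mleadc (symbol a) / mleadc (symbol b); exists c => nzc.
have sc : in_span (a - c *: b) by apply/spanB/spanZ.
set r := a - c *: b in nzc sc *.
have rE : symbol r = symbol a - c *: symbol b by rewrite linearB linearZ.
have le : (mlead (symbol r) <= mlead (symbol a))%O.
  rewrite rE; apply: le_trans (mleadB_le _ _) _.
  by rewrite leUx lexx lab mleadZ_le.
have ne : mlead (symbol r) != mlead (symbol a).
  apply: contraNneq nzc => e; rewrite -mleadc_eq0 e rE mcoeffB mcoeffZ.
  by rewrite {2}lab /c divfK ?subrr ?mleadc_eq0.
rewrite ltn_neqAle lemc_mdeg // andbT; apply: contra ne => /eqP e.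
by rewrite lab; apply/eqP/mlead_span => //; rewrite e.
Qed.

Lemma comm_scale_sub (a b t : A) (c : F) :
  (a - c *: b) * t - t * (a - c *: b) = (a * t - t * a) - c *: (b * t - t * b).
Proof.
rewrite mulrBl mulrBr -scalerAl -scalerAr scalerBr !opprB.
by rewrite addrACA [in RHS]addrACA [- _ - _]addrC.
Qed.

Lemma symbol_commutator0 a b : symbol a = 0 -> symbol (a * b - b * a) = 0.
Proof.
move=> a0; rewrite linearB /=.
have /eqP -> : symbol (a * b) == 0 by rewrite symbolM_eq0 a0 eqxx.
have /eqP -> : symbol (b * a) == 0 by rewrite symbolM_eq0 a0 eqxx orbT.
by rewrite subrr.
Qed.

Lemma symbol_u_neq0 : nz u.
Proof.
apply: contraTneq symbol1_neq0 => u0.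
by rewrite negbK -uv1 symbol_commutator0.
Qed.

(** A symbol of degree 0 is a scalar c, and then u - c has symbol zero but the
    same commutator with v as u. *)
Lemma symbol_deg_u_gt0 : (0 < deg u)%N.
Proof.
rewrite lt0n; apply: contraNneq symbol1_neq0 => du0.
have [c lt] := lower_span span_u span1 symbol_u_neq0 symbol1_neq0
  (etrans du0 (esym symbol_deg1)).
have /eqP w0 : symbol (u - c *: 1) == 0.
  by apply: contraT => /lt; rewrite du0.
have /= := comm_scale_sub u 1 v c; rewrite mul1r mulr1 subrr scaler0 subr0 uv1 => <-.
by rewrite symbol_commutator0.
Qed.

Let symbol_z_neq0 : nz z. Proof. exact/symbolX_neq0/symbol_u_neq0. Qed.

Let D := deg z.

Lemma symbol_deg_z_gt0 : (0 < D)%N.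
Proof.
rewrite /D symbol_degX ?symbol_u_neq0 // muln_gt0 symbol_deg_u_gt0.
by rewrite prime_gt0 // (pcharf_prime hp).
Qed.

(** The degrees modulo D form a finite monoid, that is a cyclic group; d is its
    least positive representative, attained up to a multiple of D by g. *)
Lemma degree_generator : exists d K g, [/\ in_span g, nz g, deg g = (d + K * D)%N &
  forall b, in_span b -> nz b -> (d %| deg b)%N].
Proof.
pose T d := (0 < d)%N /\ exists g K, [/\ in_span g, nz g & deg g = (d + K * D)%N].
have exT : exists d, `[< T d >].
  exists D; apply/asboolP; split; first exact: symbol_deg_z_gt0.
  by exists z, 0%N; rewrite addn0; split=> //; apply: span_z.
case: (ex_minnP exT) => d /asboolP[dgt0 [g [K [sg nzg dg]]]] dmin.
exists d, K, g; split=> // b sb nzb; apply: contraT => ndv.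
pose r := (deg b %% d)%N; pose q := (deg b %/ d)%N.
have rgt0 : (0 < r)%N by rewrite lt0n.
have := ltn_pmod (deg b) dgt0; rewrite -/r ltnNge dmin //.
(* Modulo D, the exponent q * (D - 1) stands for -q. *)
apply/asboolP; split=> //; exists (b * g ^+ (q * D.-1)), (q * d + K * (q * D.-1))%N.
split; [exact/spanM/spanX | exact/symbolM_neq0/symbolX_neq0 |].
rewrite symbol_degM ?symbolX_neq0 // symbol_degX // dg {1}(divn_eq (deg b) d) -/q -/r.
by have := symbol_deg_z_gt0; case: (D) => // D' _ /=; nia.
Qed.

(** Infinite descent on deg b + deg t - deg [b, t], which is a natural number
    whenever [b, t] has a nonzero symbol. *)
Lemma comm_descent g d K : in_span g -> nz g -> deg g = (d + K * D)%N ->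
  (forall b, in_span b -> nz b -> (d %| deg b)%N) ->
  forall t, in_span t -> symbol (g * t - t * g) = 0 ->
  forall b, in_span b -> symbol (b * t - t * b) = 0.
Proof.
move=> sg nzg dg dv t st gt0.
have nz_comm b : nz (b * t - t * b) -> nz b /\ nz t.
  move=> nzc; split; apply: contraNneq nzc => w0; first by rewrite symbol_commutator0.
  by rewrite -opprB linearN /= symbol_commutator0 ?oppr0.
have deg_comm b : nz (b * t - t * b) -> (deg (b * t - t * b)%R <= deg b + deg t)%N.
  move=> nzc; have [nzb nzt] := nz_comm b nzc.
  rewrite -symbol_degM // /deg; apply: lemc_mdeg; rewrite linearB.
  apply: le_trans (mleadB_le _ _) _; rewrite leUx lexx /=.
  by rewrite !mlead_symbolM // addmC.
have gt_pow e : symbol (g ^+ e * t - t * g ^+ e) = 0.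
  elim: e => [|e IH]; first by rewrite expr0 mul1r mulr1 subrr linear0.
  have -> : g ^+ e.+1 * t - t * g ^+ e.+1 =
      g * (g ^+ e * t - t * g ^+ e) + (g * t - t * g) * g ^+ e.
    by rewrite exprS mulrBr mulrBl !mulrA addrA subrK.
  have /eqP E1 : symbol (g * (g ^+ e * t - t * g ^+ e)) == 0
    by rewrite symbolM_eq0 IH eqxx orbT.
  have /eqP E2 : symbol ((g * t - t * g) * g ^+ e) == 0 by rewrite symbolM_eq0 gt0 eqxx.
  by rewrite linearD /= E1 E2 addr0.
have step b : in_span b -> nz (b * t - t * b) ->
    exists b', [/\ in_span b', nz (b' * t - t * b') &
    (deg b' + deg (b * t - t * b) < deg b + deg (b' * t - t * b'))%N].
  move=> sb nzc; have [nzb nzt] := nz_comm b nzc.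
  have [e de] := dvdnP (dv b sb nzb); pose zk := z ^+ (e * K).
  have nzzk : nz zk by apply: symbolX_neq0.
  have dzk : deg zk = (D * (e * K))%N by apply: symbol_degX.
  have szb : in_span (zk * b) by apply/spanM/sb/spanX/span_z.
  have dzb : deg (zk * b) = deg (g ^+ e).
    by rewrite (symbol_degM nzzk nzb) dzk (symbol_degX e nzg) dg de; ring.
  have [c ltc] := lower_span szb (spanX e sg) (symbolM_neq0 nzzk nzb)
    (symbolX_neq0 e nzg) dzb.
  exists (zk * b - c *: g ^+ e).
  have zt : zk * t = t * zk.
    by apply/esym/commrX; rewrite /GRing.comm central_span.
  have comm' : symbol ((zk * b - c *: g ^+ e) * t - t * (zk * b - c *: g ^+ e)) =
      symbol (zk * (b * t - t * b)).
    rewrite comm_scale_sub linearB linearZ /= gt_pow scaler0 subr0.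
    by rewrite mulrBr !mulrA zt.
  move: ltc comm'; set b' := _ - _ => ltc comm'.
  have nzc' : nz (b' * t - t * b') by rewrite comm'; apply: symbolM_neq0.
  split=> //; first exact/spanB/spanZ/spanX.
  have -> : deg (b' * t - t * b') = (deg zk + deg (b * t - t * b))%N.
    by rewrite /deg comm' -/(deg _) symbol_degM.
  have [nzb' _] := nz_comm b' nzc'; have := ltc nzb'.
  by rewrite (symbol_degM nzzk nzb) addnA ltn_add2r [(deg b + _)%N]addnC.
suff main N b : in_span b -> (deg b + deg t <= N + deg (b * t - t * b))%N ->
    symbol (b * t - t * b) = 0.
  by move=> b sb; apply: (main (deg b + deg t)%N) => //; apply: leq_addr.
elim: N b => [|N IH] b sb le; apply/eqP; apply: contraT => nzc;
  have [b' [sb' nzc' lt]] := step b sb nzc; have := deg_comm b' nzc'; first lia.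
have [le' _|gt'] := leqP (deg b' + deg t) (N + deg (b' * t - t * b')); last lia.
by rewrite (IH b' sb' le') eqxx in nzc'.
Qed.

(** The descent is used twice: with t = g, which commutes with itself, and then
    with t = v, which commutes with g by the first use. *)
Lemma dependence_absurd : False.
Proof.
have [d [K [g [sg nzg dg dv]]]] := degree_generator.
have descent := comm_descent sg nzg dg dv.
have gcomm b : in_span b -> symbol (b * g - g * b) = 0.
  by apply: descent => //; rewrite subrr linear0.
have vg : symbol (g * v - v * g) = 0.
  by rewrite -opprB linearN /= gcomm ?oppr0 //; apply: span_v.
have := descent v span_v vg u span_u; rewrite uv1 => /eqP.
by rewrite (negPf symbol1_neq0).
Qed.
End Independence.

Lemma ordered_eval_eq0 (F : fieldType) (p : nat) (hp : p \in [pchar F])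
    (A : algType F) (k : nat) (symbol : {linear A -> mpoly k F})
    (symbolP : symbol_map symbol) (u v : A) (f : {poly {poly F}}) :
  u * v - v * u = 1 -> ordered_eval u v f = 0 -> f = 0.
Proof.
move=> uv1 f0; apply/eqP; apply: contraT => nzf.
by case: (dependence_absurd hp symbolP uv1 nzf f0).
Qed.

(** * The symbol of an element of the Weyl algebra *)

Section Symbol.
Variables (F : fieldType) (n : nat).
Local Notation free := (free_alg F n).
Local Notation free2 := (free_alg F (n + n)).
Local Notation W := (weyl F n).
Local Notation P := (mpoly (n + n) F).

(** Words are built by left multiplication by generators, and span. *)
Lemma weyl_ind (Q : W -> Prop) :
  Q 1 -> (forall a b, Q a -> Q b -> Q (a + b)) ->
  (forall c a, Q a -> Q (c *: a)) ->
  (forall i a, Q a -> Q (weyl_x F i * a)) ->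
  (forall i a, Q a -> Q (weyl_y F i * a)) -> forall a, Q a.
Proof.
move=> Q1 QD QZ Qx Qy a; rewrite -[a]weyl_reprK.
rewrite [weyl_repr a]monalg.monalgE raddf_sum.
elim/big_rec: _ => [|w b _ Qb]; first by rewrite -(scale0r 1); apply: QZ.
apply: QD => //; set c := monalg.mcoeff _ _.
have -> : monalg.mkmalgU w c = c *: (monalg.mkmalgU w 1 : free).
  by apply/monalg.malgP => v; rewrite monalg.mcoeffZ !monalg.mcoeffU mulrnAr mulr1.
have QZpi (g : free) : Q (weyl_pi g) -> Q (weyl_pi (c *: g)).
  by move=> Qg; have := QZ c _ Qg; rewrite -[c *: weyl_pi g]weyl_piZ.
apply: QZpi; case: w {c} => w.
pose word (v : seq ('I_n + 'I_n)) : free := monalg.mkmalgU (monalg.FMonom v) 1.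
rewrite -/(word w); elim: w => [|k w IH].
  have -> : word [::] = 1 by rewrite /word -monalg.fmoneE.
  by rewrite rmorph1.
have -> : word (k :: w) = word [:: k] * word w.
  rewrite /word /GRing.mul /= monalg.fgmulUU mulr1.
  by congr mkmalgU; apply/val_inj; rewrite /= fmM.
have wordU : word [:: k] = monalg.mkmalgU (monalg.fmu k) 1 by rewrite /word -monalg.fmuE.
rewrite rmorphM wordU; case: k {wordU} => i; [exact: Qx | exact: Qy].
Qed.

(** The action of A_n on F[X_1..X_n] by derivatives and multiplications is not
    faithful in characteristic p.  Adding central variables Z_i repairs this: the
    operators d/dX_i + Z_i and X_i come from the action of A_2n, by sending x_i
    to x_i + y_(n+i) and y_i to y_i. *)
Definition symbol_gen (k : 'I_n + 'I_n) : free2 :=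
  match k with
  | inl i => free_x F (lshift n i) + free_y F (rshift n i)
  | inr i => free_y F (lshift n i)
  end.

Definition symbol_word (w : monalg.fmonom ('I_n + 'I_n)%type) : free2 :=
  \prod_(k <- monalg.fmonom_val w) symbol_gen k.

Lemma symbol_word_mmorphism : monalg.mmorphism symbol_word.
Proof.
split; last by rewrite /symbol_word monalg.fm1 big_nil.
by move=> w w'; rewrite /symbol_word monalg.fmM big_cat.
Qed.
HB.instance Definition _ :=
  monalg.isMultiplicative.Build (monalg.fmonom ('I_n + 'I_n)%type) free2
    symbol_word symbol_word_mmorphism.

Definition symbol_hom : free -> free2 := monalg.mmap (in_alg free2) symbol_word.

Lemma symbol_homB : zmod_morphism symbol_hom.
Proof. exact: monalg.mmap_is_additive. Qed.
HB.instance Definition _ := GRing.isZmodMorphism.Build free free2 symbol_hom symbol_homB.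

Lemma symbol_homM : monoid_morphism symbol_hom.
Proof.
have [HM H1] : multiplicative symbol_hom.
  apply: monalg.commr_mmap_is_multiplicative => g m m'.
  by rewrite /GRing.comm /= mulr_algl -free_scaleAr mulr1.
by split.
Qed.
HB.instance Definition _ := GRing.isMonoidMorphism.Build free free2 symbol_hom symbol_homM.

Lemma symbol_homU k : symbol_hom (monalg.mkmalgU (monalg.fmu k) 1) = symbol_gen k.
Proof.
rewrite /symbol_hom monalg.mmapU /= scale1r mul1r /symbol_word.
by rewrite monalg.fmU big_seq1.
Qed.

Lemma symbol_hom_x i :
  symbol_hom (free_x F i) = free_x F (lshift n i) + free_y F (rshift n i).
Proof. exact: symbol_homU. Qed.

Lemma symbol_hom_y i : symbol_hom (free_y F i) = free_y F (lshift n i).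
Proof. exact: symbol_homU. Qed.

(** In F[X_1..X_n, Z_1..Z_n] the X_i are the left variables and the Z_i the
    right ones. *)
Definition xop i (p : P) : P := p^`M(lshift n i) + 'X_(rshift n i) * p.
Definition yop i (p : P) : P := 'X_(lshift n i) * p.

Lemma xop_is_linear i : linear (xop i).
Proof. by move=> c p q; rewrite /xop linearP /= mulrDr -scalerAr scalerDr addrACA. Qed.
HB.instance Definition _ i := GRing.isLinear.Build F P P *:%R (xop i) (xop_is_linear i).

Lemma yop_is_linear i : linear (yop i).
Proof. by move=> c p q; rewrite /yop mulrDr -scalerAr. Qed.
HB.instance Definition _ i := GRing.isLinear.Build F P P *:%R (yop i) (yop_is_linear i).

Lemma xopC i j p : xop i (xop j p) = xop j (xop i p).
Proof.
rewrite /xop !mderivD !mderivM !mderivX !mnm1E !eq_rlshift !scale0r !mul0r !add0r.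
rewrite !mulrDr mderiv_comm [in RHS]mulrCA -!addrA; congr (_ + _).
by rewrite addrCA.
Qed.

Definition weyl_act (a : W) (p : P) : P := free_act (symbol_hom (weyl_repr a)) p.

Lemma symbol_hom0 : symbol_hom 0 = 0.
Proof. exact: raddf0. Qed.

Lemma symbol_hom1 : symbol_hom 1 = 1.
Proof. exact: rmorph1. Qed.

Lemma symbol_hom_add g h : symbol_hom (g + h) = symbol_hom g + symbol_hom h.
Proof. exact: raddfD. Qed.

Lemma symbol_hom_mul g h : symbol_hom (g * h) = symbol_hom g * symbol_hom h.
Proof. exact: rmorphM. Qed.

Lemma symbol_homZ c g : symbol_hom (c *: g) = c *: symbol_hom g.
Proof. by rewrite [LHS]monalg.mmapZ /= mulr_algl. Qed.

Lemma symbol_hom_sub g h : symbol_hom (g - h) = symbol_hom g - symbol_hom h.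
Proof. exact: raddfB. Qed.

Lemma symbol_hom_comm g h :
  symbol_hom (commutator g h) = commutator (symbol_hom g) (symbol_hom h).
Proof. by rewrite /commutator raddfB; congr (_ - _); apply: rmorphM. Qed.

Lemma free_act_commE (g h : free2) (A B : P -> P) p :
  free_act g =1 A -> free_act h =1 B ->
  free_act (commutator g h) p = A (B p) - B (A p).
Proof. by move=> gA hB; rewrite free_act_comm gA !hB gA. Qed.

Lemma symbol_hom_ideal g p :
  g \in @weyl_ideal F n -> free_act (symbol_hom g) p = 0.
Proof.
move/weyl_idealP => Ig; elim: Ig p => {g}.
- have Hx i : free_act (symbol_hom (free_x F i)) =1 xop i.
    by move=> q; rewrite symbol_hom_x free_actD free_act_x free_act_y.
  have Hy i : free_act (symbol_hom (free_y F i)) =1 yop i.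
    by move=> q; rewrite symbol_hom_y free_act_y.
  move=> g; case=> i j p.
  + rewrite symbol_hom_sub free_actB [symbol_hom (_ == _)%:R]rmorph_nat.
    rewrite free_actMn free_act1.
    rewrite symbol_hom_comm (free_act_commE p (Hx i) (Hy j)).
    rewrite /xop /yop mderiv_mulX mulrDr eq_lshift.
    rewrite ['X_(rshift n i) * ('X_(lshift n j) * p)]mulrCA.
    by rewrite -[X in X - _ - _]addrA addrK subrr.
  + by rewrite symbol_hom_comm (free_act_commE p (Hx i) (Hx j)) xopC subrr.
  + by rewrite symbol_hom_comm (free_act_commE p (Hy i) (Hy j)) /yop mulrCA subrr.
- by move=> p; rewrite symbol_hom0 free_act0.
- move=> g h _ IHg _ IHh p; rewrite symbol_hom_add free_actD.
  exact: etrans (congr2 +%R (IHg p) (IHh p)) (addr0 0).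
- move=> a g _ IHg p; rewrite symbol_hom_mul free_actM.
  exact: etrans (congr1 _ (IHg p)) (linear0 _).
- move=> g a _ IHg p; rewrite symbol_hom_mul free_actM; exact: IHg.
Qed.

Lemma weyl_act_pi g p : weyl_act (weyl_pi g) p = free_act (symbol_hom g) p.
Proof.
apply/eqP; rewrite -subr_eq0 -free_actB -symbol_hom_sub.
by rewrite symbol_hom_ideal // weyl_repr_ideal.
Qed.

Lemma weyl_act_is_linear a : linear (weyl_act a).
Proof. by move=> c p q; rewrite /weyl_act linearP. Qed.
HB.instance Definition _ a :=
  GRing.isLinear.Build F P P *:%R (weyl_act a) (weyl_act_is_linear a).

Lemma weyl_act1 p : weyl_act 1 p = p.
Proof. by rewrite weyl_act_pi symbol_hom1 free_act1. Qed.

Lemma weyl_actM a b p : weyl_act (a * b) p = weyl_act a (weyl_act b p).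
Proof.
rewrite -[a]weyl_reprK -[b]weyl_reprK !weyl_act_pi -free_actM -symbol_hom_mul.
by rewrite -weyl_act_pi; congr (weyl_act _ p); apply/esym/rmorphM.
Qed.

Lemma weyl_actD a b p : weyl_act (a + b) p = weyl_act a p + weyl_act b p.
Proof.
rewrite -[a]weyl_reprK -[b]weyl_reprK !weyl_act_pi -free_actD -symbol_hom_add.
by rewrite -weyl_act_pi; congr (weyl_act _ p); apply/esym/raddfD.
Qed.

Lemma free_actZ (c : F) (g : free2) (p : P) : free_act (c *: g) p = c *: free_act g p.
Proof.
have le := monalg.msuppZ_le c g; rewrite (free_actEw p le) scaler_sumr.
by apply: eq_bigr => w _; rewrite monalg.mcoeffZ scalerA.
Qed.

Lemma weyl_actZ c a p : weyl_act (c *: a) p = c *: weyl_act a p.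
Proof.
rewrite -[a]weyl_reprK weyl_act_pi -free_actZ -symbol_homZ -weyl_act_pi.
by congr (weyl_act _ p); apply/esym/weyl_piZ.
Qed.

Lemma weyl_act_x i p : weyl_act (weyl_x F i) p = xop i p.
Proof. by rewrite weyl_act_pi symbol_hom_x free_actD free_act_x free_act_y. Qed.

Lemma weyl_act_y i p : weyl_act (weyl_y F i) p = yop i p.
Proof. by rewrite weyl_act_pi symbol_hom_y free_act_y. Qed.

(** A list of indices keeps the order of composition explicit; commutation makes
    it irrelevant (op_opow). *)
Section Opow.
Variable op : 'I_n -> P -> P.
Hypothesis opC : forall i j p, op i (op j p) = op j (op i p).

Definition opow (al : 'I_n -> nat) (s : seq 'I_n) (p : P) : P :=
  foldr (fun i q => iter (al i) (op i) q) p s.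

Lemma eq_opow al be s p : {in s, al =1 be} -> opow al s p = opow be s p.
Proof.
elim: s => //= i s IH e; rewrite e ?mem_head // IH // => j js.
by rewrite e // in_cons js orbT.
Qed.

Lemma op_iterC i j k p : op i (iter k (op j) p) = iter k (op j) (op i p).
Proof. by elim: k => //= k <-. Qed.

Lemma op_opow i al s p : uniq s -> i \in s ->
  op i (opow al s p) = opow (fun j => al j + (i == j))%N s p.
Proof.
elim: s => //= j s IH /andP[js us]; rewrite in_cons.
have [-> _|ij /= is_] := eqVneq i j.
  rewrite /= addn1 /=; congr (op j (iter _ _ _)); apply: eq_opow => k ks.
  by case: eqP => [e|_]; [move: js; rewrite e ks | rewrite addn0].
by rewrite op_iterC IH // addn0.
Qed.
End Opow.

Lemma msize_mderiv (i : 'I_(n + n)) (p : P) : (msize p^`M(i) <= msize p)%N.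
Proof.
rewrite /mderiv; apply: leq_trans (mmeasure_sum _ _ _ _) _.
apply/bigmax_leqP_seq => m mp _; apply: leq_trans (mmeasureZ_le _ _ _) _.
by rewrite msizeX; apply: leq_trans (msize_mdeg_lt mp); rewrite ltnS mdegB.
Qed.

Lemma msize_mulX (m : 'X_{1..n + n}) (p : P) : (msize ('X_[m] * p) <= mdeg m + msize p)%N.
Proof.
have [->|nzp] := eqVneq p 0; first by rewrite mulr0 mmeasure0.
have nzX : 'X_[m] != 0 :> P by rewrite -msize_poly_eq0 msizeX.
by rewrite msizeM // msizeX.
Qed.

Definition near_mul (m : 'X_{1..n + n}) (Phi : P -> P) :=
  forall g, g != 0 -> (msize (Phi g - 'X_[m] * g) < mdeg m + msize g)%N.

(** In d/dX_i + Z_i the derivative only contributes lower terms. *)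
Lemma near_xop i m Phi : near_mul m Phi ->
  near_mul (U_(rshift n i) + m)%MM (xop i \o Phi).
Proof.
move=> near g nzg; have lt := near g nzg; rewrite /= /xop mpolyXD -mulrA -addrA -mulrBr.
have le : (msize (Phi g) <= mdeg m + msize g)%N.
  rewrite -[Phi g](subrK ('X_[m] * g)); apply: leq_trans (msizeD_le _ _) _.
  by rewrite geq_max msize_mulX ltnW.
apply: leq_ltn_trans (msizeD_le _ _) _; rewrite gtn_max mdegD mdeg1 add1n.
apply/andP; split.
  exact: leq_ltn_trans (msize_mderiv _ _) _.
by apply: leq_ltn_trans (msize_mulX _ _) _; rewrite mdeg1 add1n.
Qed.

Lemma near_iter_xop i k m Phi : near_mul m Phi ->
  near_mul (U_(rshift n i) *+ k + m)%MM (iter k (xop i) \o Phi).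
Proof.
move=> near; elim: k => [|k IH]; first by rewrite mulm0n add0m.
rewrite mulmS -addmA; exact: near_xop.
Qed.

Lemma near_opow al s :
  near_mul (\sum_(i <- s) U_(rshift n i) *+ al i)%MM (opow xop al s).
Proof.
elim: s => [|i s IH].
  by move=> g nzg; rewrite big_nil mpolyX0 mul1r subrr mmeasure0 mdeg0 lt0n msize_poly_eq0.
rewrite big_cons; exact: near_iter_xop.
Qed.

(** The part of a monomial in the variables X_i. *)
Definition lmon (m : 'X_{1..n + n}) : 'X_{1..n + n} :=
  [multinom (if (j < n)%N then m j else 0%N) | j < n + n].

(** The operator attached to X^alpha Z^beta: beta becomes powers of the
    commuting operators d/dX_i + Z_i, applied before multiplication by X^alpha. *)
Definition star_mon (m : 'X_{1..n + n}) (g : P) : P :=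
  'X_[lmon m] * opow xop (fun i => m (rshift n i)) (enum 'I_n) g.

Lemma near_star_mon m : near_mul m (star_mon m).
Proof.
set r := (\sum_(i <- enum 'I_n) U_(rshift n i) *+ m (rshift n i))%MM.
have em : m = (lmon m + r)%MM.
  apply/mnmP => j; rewrite mnmDE mnmE mnm_sumE big_enum /=.
  case: (split_ordP j) => k ->.
    rewrite big1 ?addn0 // => i _.
    by rewrite mulmnE mnm1E eq_rlshift mul0n.
  rewrite add0n (bigD1 k) //= mulmnE mnm1E eqxx mul1n.
  rewrite big1 ?addn0 // => i ik.
  by rewrite mulmnE mnm1E eq_rshift (negPf ik).
move=> g nzg; have lt := near_opow (fun i => m (rshift n i)) (enum 'I_n) nzg.
have -> : mdeg m = (mdeg (lmon m) + mdeg r)%N by rewrite -mdegD -em.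
have -> : 'X_[m] = 'X_[lmon m] * 'X_[r] :> P by rewrite -mpolyXD -em.
rewrite /star_mon -mulrA -mulrBr -addnA.
by apply: leq_ltn_trans (msize_mulX _ _) _; rewrite ltn_add2l.
Qed.

Lemma yop_star_mon i m g : yop i (star_mon m g) = star_mon (m + U_(lshift n i))%MM g.
Proof.
rewrite /yop /star_mon mulrA -mpolyXD; congr ('X_[_] * _).
  apply/mnmP => j; rewrite !mnmE addnC; case: ifP => // jn.
  by case: eqP jn => // <- /=; rewrite ltn_ord.
by apply: eq_opow => j _; rewrite mnmDE mnm1E eq_lrshift addn0.
Qed.

(** Moving d/dX_i + Z_i to the right of X^alpha produces the derivative of
    X^alpha; the right-hand side is star applied to xop i of the monomial m. *)
Lemma xop_star_mon i m g : xop i (star_mon m g) =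
  (m (lshift n i))%:R *: star_mon (m - U_(lshift n i))%MM g +
  star_mon (m + U_(rshift n i))%MM g.
Proof.
rewrite /xop {1 2}/star_mon mderivM mderivX mulrCA -addrA -mulrDr -/(xop i _).
congr (_ + _).
  rewrite -scalerAl mnmE /= ltn_ord; congr (_ *: (_ * _)).
    congr 'X_[_]; apply/mnmP => j; rewrite !mnmE; case: ifP => // jn.
  by apply: eq_opow => j _; rewrite mnmBE mnm1E eq_lrshift subn0.
rewrite op_opow ?enum_uniq ?mem_enum //; last exact: xopC.
congr ('X_[_] * _).
  apply/mnmP => j; rewrite !mnmE; case: ifP => // jn.
  by case: eqP jn => [<-|]; rewrite ?addn0 //= ltnNge leq_addr.
by apply: eq_opow => j _; rewrite mnmDE mnm1E eq_rshift.
Qed.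

(** The product of symbols that corresponds to the product of the Weyl algebra
    (normal ordering). *)
Definition star (f g : P) : P := \sum_(m <- msupp f) f@_m *: star_mon m g.

Lemma starwE d f g : uniq d -> {subset msupp f <= d} ->
  star f g = \sum_(m <- d) f@_m *: star_mon m g.
Proof.
move=> ud fd; rewrite (bigID (mem (msupp f))) /= [X in _ + X]big1 => [|m]; last first.
  by move/memN_msupp_eq0->; rewrite scale0r.
rewrite addr0 -big_filter; apply/perm_big/uniq_perm; rewrite ?filter_uniq ?msupp_uniq //.
by move=> m; rewrite mem_filter; case: (boolP (m \in msupp f)) => // /fd ->.
Qed.

(* The same function with the linear argument last. *)
Definition star_right g f := star f g.

Lemma star_is_linear g : linear (star_right g).
Proof.
move=> c f1 f2; rewrite /star_right; set f := c *: f1 + f2.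
pose d := undup (msupp f ++ msupp f1 ++ msupp f2).
rewrite !(@starwE d) ?undup_uniq //; last 1 first.
- by move=> m mf; rewrite mem_undup !mem_cat mf.
- rewrite scaler_sumr -big_split /=; apply: eq_bigr => m _.
  by rewrite mcoeffD mcoeffZ scalerDl scalerA.
- by move=> m mf; rewrite mem_undup !mem_cat mf !orbT.
- by move=> m mf; rewrite mem_undup !mem_cat mf !orbT.
Qed.
HB.instance Definition _ g :=
  GRing.isLinear.Build F P P *:%R (star_right g) (star_is_linear g).

Lemma starX m g : star 'X_[m] g = star_mon m g.
Proof. by rewrite /star msuppX big_seq1 mcoeffX eqxx scale1r. Qed.

Lemma star0 g : star 0 g = 0.
Proof. exact: (linear0 (star_right g)). Qed.
Lemma starD f1 f2 g : star (f1 + f2) g = star f1 g + star f2 g.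
Proof. exact: (linearD (star_right g)). Qed.
Lemma starZ c f g : star (c *: f) g = c *: star f g.
Proof. exact: (linearZ_LR (star_right g)). Qed.
Lemma star_sum (I : Type) (r : seq I) (f : I -> P) g :
  star (\sum_(i <- r) f i) g = \sum_(i <- r) star (f i) g.
Proof. exact: (linear_sum (star_right g)). Qed.

Lemma star1 g : star 1 g = g.
Proof.
rewrite -mpolyX0 starX /star_mon; have -> : lmon 0 = 0%MM.
  by apply/mnmP => j; rewrite !mnmE; case: ifP.
rewrite mpolyX0 mul1r.
by elim: (enum _) => //= i s ->; rewrite mnm0E.
Qed.

Lemma star_yop i f g : star (yop i f) g = yop i (star f g).
Proof.
rewrite {1}[f]mpolyE !linear_sum star_sum /=; apply: eq_bigr => m _.
by rewrite !linearZ starZ /= yop_star_mon {1}/yop -mpolyXD starX addmC.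
Qed.

Lemma star_xop i f g : star (xop i f) g = xop i (star f g).
Proof.
rewrite {1}[f]mpolyE !linear_sum star_sum /=; apply: eq_bigr => m _.
rewrite !linearZ starZ /= xop_star_mon {1}/xop -mpolyXD mderivX.
by rewrite starD starZ !starX addmC.
Qed.

Definition weyl_symbol (a : W) : P := weyl_act a 1.

(** Normal ordering: an element acts as the normally ordered operator of its
    symbol.  Both sides are linear in a and compatible with left multiplication by
    the generators. *)
Lemma weyl_act_star a g : weyl_act a g = star (weyl_symbol a) g.
Proof.
move: a; apply: weyl_ind; rewrite /weyl_symbol.
- by rewrite !weyl_act1 star1.
- by move=> a b IHa IHb; rewrite !weyl_actD starD IHa IHb.
- by move=> c a IHa; rewrite !weyl_actZ starZ IHa.
- by move=> i a IHa; rewrite !weyl_actM !weyl_act_x star_xop IHa.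
- by move=> i a IHa; rewrite !weyl_actM !weyl_act_y star_yop IHa.
Qed.

(** Only the top degree matters, so f may mix monomials: each of them
    contributes an error of degree less than the degree of f * g. *)
Lemma near_star f g : f != 0 -> g != 0 ->
  (msize (star f g - f * g) < msize (f * g))%N.
Proof.
move=> nzf nzg; rewrite msizeM // {2}[f]mpolyE mulr_suml -sumrB.
have f_gt0 : (0 < msize f)%N by rewrite lt0n msize_poly_eq0.
have g_gt0 : (0 < msize g)%N by rewrite lt0n msize_poly_eq0.
apply: leq_ltn_trans (mmeasure_sum _ _ _ _) _.
rewrite -[X in (_ < X)%N]prednK; last by rewrite -subn1 subn_gt0 (leq_add f_gt0 g_gt0).
rewrite ltnS; apply/bigmax_leqP_seq => m mf _.
rewrite -scalerAl -scalerBr; apply: leq_trans (mmeasureZ_le _ _ _) _.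
have := near_star_mon m nzg; have := msize_mdeg_lt mf.
set k := msize (_ - _); move: k (msize g) (msize f) (mdeg m) => k a b c; lia.
Qed.

Lemma mlead_star f g : f != 0 -> g != 0 ->
  star f g != 0 /\ mlead (star f g) = (mlead f + mlead g)%MM.
Proof.
move=> nzf nzg; have lt := near_star nzf nzg.
have nzfg : f * g != 0 by rewrite mulf_neq0.
have nz : star f g != 0.
  by apply: contraTneq lt => ->; rewrite sub0r msizeN ltnn.
split=> //; rewrite -mleadM //.
have [->//|nzd] := eqVneq (star f g) (f * g).
rewrite -[star f g](subrK (f * g)); apply: mleadDr; apply: lt_mdeg_ltmc.
by rewrite -ltnS !mlead_deg // subr_eq0.
Qed.

Lemma weyl_symbol_star a b : weyl_symbol (a * b) = star (weyl_symbol a) (weyl_symbol b).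
Proof. by rewrite -weyl_act_star -weyl_actM. Qed.

Lemma weyl_symbol_is_linear : linear weyl_symbol.
Proof. by move=> c a b; rewrite /weyl_symbol weyl_actD weyl_actZ. Qed.
HB.instance Definition _ := GRing.isLinear.Build F W P *:%R
  weyl_symbol weyl_symbol_is_linear.

Lemma weyl_symbol1 : weyl_symbol 1 = 1.
Proof. exact: weyl_act1. Qed.

Lemma weyl_symbolM_eq0l a b : weyl_symbol a = 0 -> weyl_symbol (a * b) = 0.
Proof. by rewrite weyl_symbol_star => ->; rewrite star0. Qed.

Lemma weyl_symbolM_eq0r a b : weyl_symbol b = 0 -> weyl_symbol (a * b) = 0.
Proof. by rewrite /weyl_symbol weyl_actM => ->; rewrite linear0. Qed.

Lemma weyl_symbolM_neq0 a b :
  weyl_symbol a != 0 -> weyl_symbol b != 0 -> weyl_symbol (a * b) != 0.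
Proof. by rewrite weyl_symbol_star => nza nzb; case: (mlead_star nza nzb). Qed.

Lemma mlead_weyl_symbolM a b : weyl_symbol a != 0 -> weyl_symbol b != 0 ->
  mlead (weyl_symbol (a * b)) = (mlead (weyl_symbol a) + mlead (weyl_symbol b))%MM.
Proof. by rewrite weyl_symbol_star => nza nzb; case: (mlead_star nza nzb). Qed.
End Symbol.

Lemma weyl_symbolP (F : fieldType) (n : nat) : symbol_map (@weyl_symbol F n).
Proof.
split; first exact: weyl_symbol1; last exact: mlead_weyl_symbolM.
move=> a b; apply/idP/idP; last first.
  by case/orP=> /eqP z; apply/eqP; [apply: weyl_symbolM_eq0l | apply: weyl_symbolM_eq0r].
by apply: contraLR; rewrite negb_or => /andP[]; apply: weyl_symbolM_neq0.
Qed.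

(** * Injectivity *)

Lemma rmorph_ordered_eval (F : fieldType) (A B : algType F)
    (phi : {lrmorphism A -> B}) (u v : A) (q : {poly {poly F}}) :
  phi (ordered_eval u v q) = ordered_eval (phi u) (phi v) q.
Proof.
have phi_horner c : phi (horner_alg u c) = horner_alg (phi u) c.
  elim/poly_ind: c => [|c a IH]; first by rewrite !rmorph0.
  by rewrite !rmorphD !rmorphM /= IH !horner_algX !horner_algC rmorph_alg.
elim/poly_ind: q => [|q c IH]; first by rewrite !raddf0.
rewrite !raddfD /= !ordered_evalMX rmorphM /= IH; congr (_ + _).
by rewrite -[c%:P]mulr1 !ordered_evalCM !ordered_eval1 !mulr1 phi_horner.
Qed.

Lemma lrmorphism_inj_of_symbol (F : fieldType) (p : nat) (A B : algType F) (k : nat)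
    (phi : {lrmorphism A -> B}) (symbol : {linear B -> mpoly k F}) (u v : A) :
  p \in [pchar F] -> symbol_map symbol -> u * v - v * u = 1 ->
  (forall a, exists q, ordered_eval u v q = a) -> injective phi.
Proof.
move=> hp symbolP uv1 gen a b eab; apply/eqP; rewrite -subr_eq0.
have [q qE] := gen (a - b); rewrite -qE.
have uv1' : phi u * phi v - phi v * phi u = 1 by rewrite -!rmorphM -rmorphB uv1 rmorph1.
have -> : q = 0.
  apply: (ordered_eval_eq0 hp symbolP uv1').
  by rewrite -rmorph_ordered_eval qE rmorphB /= eab subrr.
by rewrite raddf0.
Qed.

Lemma weyl1_comm (F : fieldType) :
  weyl_x F (ord0 : 'I_1) * weyl_y F ord0 - weyl_y F ord0 * weyl_x F ord0 = 1.
Proof. exact: (weyl_comm_xy F (ord0 : 'I_1) ord0). Qed.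

Lemma weyl1_ordered_eval (F : fieldType) (a : weyl F 1) :
  exists q, ordered_eval (weyl_x F ord0) (weyl_y F ord0) q = a.
Proof.
move: a; apply: weyl_ind.
- by exists 1; rewrite ordered_eval1.
- by move=> a b [q <-] [r <-]; exists (q + r); rewrite raddfD.
- by move=> c a [q <-]; exists (c%:P%:P * q); rewrite ordered_evalZ.
- by move=> i a [q <-]; exists ('X%:P * q); rewrite (ord1 i) ordered_evalXM.
- by move=> i a [q <-]; exists (lmulv q);
    rewrite (ord1 i) (ordered_eval_lmulv (weyl1_comm F)).
Qed.

Theorem theorem2 (F : fieldType) (p : nat) (hp : p \in [pchar F])
  (n : nat) (hn : (1 <= n)%N)
  (phi : {lrmorphism weyl F 1 -> weyl F n}) : injective phi.
Proof.
exact: (lrmorphism_inj_of_symbol hp (weyl_symbolP F n) (weyl1_comm F)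
  (@weyl1_ordered_eval F)).
Qed.
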